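(* Let $q\geq 2$ be an integer and $K$ a number field with $K\cap\mathbb{Q}(\zeta_q)=\mathbb{Q}$, and let $d$ be a positive integer. If the Gun–Murty–Rath conjecture is true, then $\dim_K V_{4d+2}(K)\geq 2$.
   Context: $\zeta_q=e^{2\pi i/q}$, $\varphi$ is Euler's totient function, and for $0<x\leq 1$, $\Re(s)>1$, $\zeta(s,x)=\sum_{n=0}^\infty (n+x)^{-s}$ is the Hurwitz zeta function. For positive integers $k,s_1,\dots,s_k$ with $s_1>1$, the multiple zeta value is $\zeta(s_1,\dots,s_k)=\sum_{n_1>n_2>\dots>n_k\geq 1} n_1^{-s_1}\cdots n_k^{-s_k}$; its weight is $s_1+\dots+s_k$. For an integer $p>1$, the generalized Zagier space $V_p(K)$ is the $K$-linear span (inside $\mathbb{C}$) of all multiple zeta values $\zeta(s_1,\dots,s_k)$ (any length $k\geq1$, $s_1>1$) of weight $s_1+\dots+s_k=p$. The Gun–Murty–Rath conjecture asserts: for every number field $F$ and all integers $k>1$, $q'\geq 2$ with $F\cap\mathbb{Q}(\zeta_{q'})=\mathbb{Q}$, the $\varphi(q')$ real numbers $\zeta(k,a/q')$, $1\leq a<q'$, $\gcd(a,q')=1$, are linearly independent over $F$. *)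

(* Defs.v *)
From HB Require Import structures.
From mathcomp Require Import all_boot all_order all_algebra all_field.
From mathcomp Require Import complex.
From mathcomp Require Import all_classical all_reals all_analysis.
Import Order.TTheory GRing.Theory Num.Theory.
Import numFieldNormedType.Exports.

Set Implicit Arguments.
Unset Strict Implicit.
Unset Printing Implicit Defensive.

Local Open Scope classical_set_scope.
Local Open Scope ring_scope.
Local Open Scope complex_scope.

(* The complex numbers are R[i] for R : realType. *)

Section Defs.
Variable R : realType.
Local Notation C := R[i].

Definition subfield (F : set C) : Prop := GRing.divring_closed (mem F).

Definition Qset : set C := range (ratr : rat -> C).

Definition Qadjoin (z : C) : set C := smallest subfield [set z].

(* Number fields are taken inside C: images of finite extensions of Q under
   a field embedding. *)
Definition number_field (F : set C) : Prop :=
  exists (L : fieldExtType rat) (iota : {rmorphism L -> C}), F = range iota.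

(* exp (2 i pi / q), in the form given by Euler's formula. *)
Definition zeta_root (q : nat) : C :=
  cos (2 * pi / q%:R) +i* sin (2 * pi / q%:R).

Definition lin_indep (F : set C) (I : finType) (v : I -> C) : Prop :=
  forall c : I -> C, (forall i, F (c i)) ->
    \sum_i c i * v i = 0 -> forall i, c i = 0.

Definition lin_span (F S : set C) : set C :=
  [set x | exists (n : nat) (c v : 'I_n -> C),
    [/\ forall i, F (c i), forall i, S (v i) & x = \sum_i c i * v i]].

Definition is_basis (F V : set C) (n : nat) (b : 'I_n -> C) : Prop :=
  lin_indep F b /\ lin_span F (range b) = V.

(* The size of a finite basis of the F-linear space V. The default value 0 is
   used only when V has no finite basis. *)
Definition dimension (F V : set C) : nat :=
  xget 0%N [set n | exists b : 'I_n -> C, is_basis F V b].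

(* zeta(k, x), only for integer exponents k > 1. *)
Definition hurwitz_zeta (k : nat) (x : R) : R :=
  limn (series (fun n => (n%:R + x) ^- k)).

Definition mzv_index (k : nat) : set (k.-tuple nat) :=
  [set n | sorted gtn n /\ all (ltn 0%N) n].
Arguments mzv_index : clear implicits.

(* The terms are nonnegative, so the multiple series is the unordered sum over
   its index set; it is finite for the exponents in mzv_exponents. *)
Definition mzv (s : seq nat) : R :=
  fine (\esum_(n in mzv_index (size s))
    (\prod_(i < size s) (tnth n i)%:R ^- (nth 0%N s i))%:E).

(* Here 1 < head 0 s also says that s is nonempty. *)
Definition mzv_exponents (s : seq nat) : Prop :=
  all (ltn 0%N) s /\ (1 < head 0 s)%N.

Definition zagier_space (F : set C) (p : nat) : set C :=
  lin_span F [set x | exists s : seq nat,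
    [/\ mzv_exponents s, sumn s = p & x = (mzv s)%:C]].

Definition gun_murty_rath : Prop :=
  forall (F : set C) (k q : nat),
    number_field F -> (1 < k)%N -> (2 <= q)%N ->
    F `&` Qadjoin (zeta_root q) = Qset ->
    lin_indep F (fun a : {a : 'I_q | (1 <= a)%N && coprime a q} =>
      (hurwitz_zeta k ((val a)%:R / q%:R))%:C).

End Defs.

Arguments Qset : clear implicits.
Arguments mzv_index : clear implicits.

(* Main.v *)
Require Import Defs.
From mathcomp Require Import all_boot all_order all_algebra all_field.
From mathcomp Require Import complex.
From mathcomp Require Import all_classical all_reals all_analysis.
From mathcomp Require Import ring lra zify.
Import Order.TTheory GRing.Theory Num.Theory.
Import numFieldNormedType.Exports.

(* Put k = 2d+1, and let P(s) be the sum of (4n+1)^-s over all integers n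
   (symmetrically for s = 1).  Multiplying two such sums and decomposing into
   partial fractions gives
     sum_{0<a<s} P(a) P(s-a) = (s-1) P(s)   for s >= 3,
   and the same argument with alternating signs gives P(2) = 2 P(1)^2.  Hence
   P(s) is a rational multiple of P(1)^s; in particular so is zeta(2k) of
   P(1)^2k, and P(k) of P(1)^k, and the number pi is never needed.

   Since zeta(k)^2 = 2 zeta(k,k) + zeta(2k) and zeta(2k) both lie in
   V_{4d+2}(K), dimension < 2 would make zeta(k)^2 / zeta(2k) an element of K,
   so theta = zeta(k) / P(1)^k would be algebraic.  Then F = Q(theta) is a real
   number field, and F meets Q(i) in Q.  Now zeta(k,1/4) + zeta(k,3/4) is a
   nonzero rational multiple of zeta(k), while zeta(k,1/4) - zeta(k,3/4) = 4^k P(k)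
   is a rational multiple of P(1)^k.  This is a linear relation over F,
   contradicting the conjecture for F and q' = 4. *)

Set Implicit Arguments.
Unset Strict Implicit.
Unset Printing Implicit Defensive.

Local Open Scope classical_set_scope.
Local Open Scope ring_scope.
Local Open Scope complex_scope.

(** * Linear spans over a number field *)

Section Span.
Variables (R : realType) (L : fieldExtType rat) (iota : {rmorphism L -> R[i]}).
Local Notation C := R[i].
Local Notation K := (range iota : set C).
Implicit Types (S V : set C) (x y a : C).

Definition submodule V :=
  [/\ V 0, forall x y, V x -> V y -> V (x + y) &
      forall a x, K a -> V x -> V (a * x)].

Lemma range_rmorph0 : K 0. Proof. by exists 0; rewrite ?rmorph0. Qed.
Lemma range_rmorph1 : K 1. Proof. by exists 1; rewrite ?rmorph1. Qed.
Lemma range_rmorphN a : K a -> K (- a).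
Proof. by move=> [x _ <-]; exists (- x); rewrite ?rmorphN. Qed.
Lemma range_rmorphM a b : K a -> K b -> K (a * b).
Proof. by move=> [x _ <-] [y _ <-]; exists (x * y); rewrite ?rmorphM. Qed.
Lemma range_rmorphV a : K a -> K a^-1.
Proof. by move=> [x _ <-]; exists x^-1; rewrite ?fmorphV. Qed.

Lemma sub_lin_span S x : S x -> lin_span K S x.
Proof.
move=> Sx; exists 1%N, (fun=> 1), (fun=> x); split=> //.
- by move=> _; exact: range_rmorph1.
- by rewrite big_ord1 mul1r.
Qed.

Lemma span_submodule S : submodule (lin_span K S).
Proof.
split.
- exists 0%N, (fun=> 0), (fun=> 0); split; try by case.
  by rewrite big_ord0.
- move=> x y [m [c [v [Kc Sv ->]]]] [n [d [w [Kd Sw ->]]]].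
  exists (m + n)%N, (fun i => match fintype.split i with inl j => c j | inr j => d j end),
    (fun i => match fintype.split i with inl j => v j | inr j => w j end).
  split=> [i|i|]; [by case: fintype.split|by case: fintype.split|].
  rewrite big_split_ord /=; congr (_ + _); apply: eq_bigr => i _.
  + by case: split_ordP => j /eqP; rewrite ?eq_lrshift // => /eqP/lshift_inj ->.
  + by case: split_ordP => j /eqP; rewrite ?eq_rlshift // => /eqP/rshift_inj ->.
- move=> a _ Ka [n [c [v [Kc Sv ->]]]].
  exists n, (fun i => a * c i), v; split=> // [i|].
    exact: range_rmorphM.
  by rewrite mulr_sumr; apply: eq_bigr => i _; rewrite mulrA.
Qed.

Lemma submodule_sum V (I : Type) (r : seq I) (P : pred I) (c v : I -> C) :
  submodule V -> (forall i, K (c i)) -> (forall i, P i -> V (v i)) ->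
  V (\sum_(i <- r | P i) c i * v i).
Proof.
move=> [V0 VD VZ] Kc Vv; elim/big_rec: _ => // i x Pi Vx.
by apply: VD => //; apply: VZ => //; exact: Vv.
Qed.

Lemma span_min S V : submodule V -> S `<=` V -> lin_span K S `<=` V.
Proof.
move=> Vmod SV _ [n [c [v [Kc Sv ->]]]].
by apply: submodule_sum => // i _; apply: SV.
Qed.

(** Among the families spanning this space, one of least size is independent: a nontrivial relation
    would allow one of its vectors to be dropped. *)
Lemma span_finite_basis S : finite_set S ->
  exists n (b : 'I_n -> C), is_basis K (lin_span K S) b.
Proof.
move=> /finite_seqP [l ->].
pose spans n := `[<exists b : 'I_n -> C,
  lin_span K (range b) = lin_span K [set` l]>].
have ex_spans : exists n, spans n.
  exists (size l); apply/asboolP; exists (tnth (in_tuple l)).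
  congr lin_span; apply/seteqP; split => x /=.
  - by move=> [i _ <-]; rewrite mem_tnth.
  - by move=> /(tnthP (in_tuple l)) [i ->]; exists i.
case: (ex_minnP ex_spans) => n /asboolP [b bspan] nmin.
exists n, b; split => // c Kc sum0 i; apply: contrapT => /eqP ci0.
case: n => [|n] in b bspan nmin c Kc sum0 i ci0 *; first by case: i ci0.
suff: (n < n)%N by rewrite ltnn.
apply: nmin; apply/asboolP; exists (b \o lift i); rewrite -bspan.
have smod := span_submodule (range (b \o lift i)).
apply/seteqP; split; apply: span_min => //; first exact: span_submodule.
  by move=> _ [j _ <-]; apply: sub_lin_span; exists (lift i j).
move=> _ [j _ <-]; case: (unliftP i j) => [k ->|->].
  by apply: sub_lin_span; exists k.
(* The relation, solved for the vector whose coefficient is nonzero. *)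
have -> : b i = \sum_(k < n) (- (c i)^-1 * c (lift i k)) * (b \o lift i) k.
  move: sum0; rewrite (bigD1_ord i) //= => /eqP; rewrite addr_eq0 => /eqP sum0.
  rewrite -[LHS](mulKf ci0) sum0 mulrN -mulNr mulr_sumr.
  by apply: eq_bigr => k _; rewrite mulrA.
apply: submodule_sum => // k; last by move=> _; apply: sub_lin_span; exists k.
by apply: range_rmorphM => //; apply/range_rmorphN/range_rmorphV.
Qed.

Lemma proportional_of_dimension_lt2 S x y : finite_set S ->
  (dimension K (lin_span K S) < 2)%N ->
  lin_span K S x -> lin_span K S y -> x != 0 -> exists2 a, K a & y = a * x.
Proof.
move=> finS; rewrite /dimension; have [n0 [b0 b0P]] := span_finite_basis finS.
set n := xget _ _.
(* A finite basis exists, so [xget] returns the size of an actual basis and not the default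
   value. *)
have : exists b : 'I_n -> C, is_basis K (lin_span K S) b.
  by apply: (@xgetPex _ _ [set n | exists b : 'I_n -> C, _ b]); exists n0, b0.
clearbody n; move=> [b [_ <-]]; case: n => [|[|n]] // in b *; move=> _.
  move=> xs _ /negP[]; apply/eqP; move: x xs.
  apply: span_min; last by move=> z [i _ _]; case: i.
  split=> // [u v -> ->|u v _ ->]; first by rewrite addr0.
  by rewrite mulr0.
have line z : lin_span K (range b) z -> exists2 a, K a & z = a * b ord0.
  move: z; apply: span_min; last first.
    move=> _ [i _ <-]; exists 1; first exact: range_rmorph1.
    by rewrite (ord1 i) mul1r.
  split.
  - by exists 0; [exact: range_rmorph0|rewrite mul0r].
  - move=> _ _ [_ [u _ <-] ->] [_ [v _ <-] ->].
    by exists (iota (u + v)); [exists (u + v)|rewrite rmorphD mulrDl].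
  - move=> a _ Ka [u Ku ->].
    by exists (a * u); [exact: range_rmorphM|rewrite mulrA].
move=> /line [u Ku ->] /line [v Kv ->]; rewrite mulf_eq0 negb_or => /andP[u0 _].
exists (v / u); last by rewrite mulrA divfK.
by apply: range_rmorphM => //; exact: range_rmorphV.
Qed.

End Span.

(** * Number fields generated by one algebraic number *)

Section NumberFields.
Variable R : realType.
Local Notation C := R[i].
Local Notation ratC := (ratr : rat -> C).

Definition algebraic_number (z : C) :=
  exists2 p : {poly rat}, p != 0 & root (map_poly ratr p) z.

(** The minimal polynomial over the prime field has rational coefficients, and [iota] acts on them
    as [ratr]. *)
Lemma algebraic_number_range (L : fieldExtType rat) (iota : {rmorphism L -> C}) x :
  algebraic_number (iota x).
Proof.
have /polyOver1P [p Dp] := minPolyOver 1%AS x.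
exists p.
  by have := monic_neq0 (monic_minPoly 1%AS x); rewrite Dp map_poly_eq0.
have := root_minPoly 1%AS x; rewrite Dp -(fmorph_root iota) -map_poly_comp.
congr (root _ _); apply: eq_map_poly => r /=.
by rewrite -(fmorph_eq_rat (iota \o in_alg L)).
Qed.

Lemma algebraic_number_sqrt z : algebraic_number (z ^+ 2) -> algebraic_number z.
Proof.
move=> [p p0 pz]; exists (p \Po 'X^2).
  (* The coefficient of [p \Po 'X^2] at [i * 2] is that of [p] at [i], so the composite is
     nonzero. *)
  apply: contra_neq p0 => p20; apply/polyP => i; rewrite coef0.
  have := coef0 rat (i * 2); rewrite -p20 coef_comp_poly_Xn //.
  by rewrite dvdn_mull // mulnK.
by rewrite rootE map_comp_poly map_polyXn horner_comp hornerXn.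
Qed.

(** Every element of Q(z) is a polynomial in z, so closure of [V] under sums and products is enough
    for minimality. This clause later shows that the field is real. *)
Lemma simple_number_field z : algebraic_number z ->
  exists2 F : set C, number_field F &
    F z /\ forall V : set C, V z -> (forall r : rat, V (ratr r)) ->
      (forall x y, V x -> V y -> V (x + y)) ->
      (forall x y, V x -> V y -> V (x * y)) -> F `<=` V.
Proof.
move=> [p0 p0_neq0 p0z].
pose P n := `[<exists p : {poly rat},
  [/\ size p = n, p != 0 & root (map_poly ratC p) z]>].
have exP : exists n, P n by exists (size p0); apply/asboolP; exists p0.
(* An annihilating polynomial of least size is irreducible, so adjoining its root gives a field. *)
case: (ex_minnP exP) => _ /asboolP [p [<- p_neq0 pz]] pmin.
have irr_p : irreducible_poly p.
  apply/(subfx_irreducibleP pz p_neq0) => q qz q_neq0.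
  by apply: pmin; apply/asboolP; exists q.
exists (range (subfx_inj : SubFieldExtType pz irr_p -> C)).
  by exists (SubFieldExtType pz irr_p), subfx_inj.
split.
  by exists (subfx_root (ratr : {rmorphism rat -> C}) z p); rewrite // subfx_inj_root.
move=> V Vz VQ VD VM _ [x _ <-].
have [q ->] := subfxE x; rewrite subfx_inj_eval //.
elim/poly_ind: q => [|q c IH]; first by have := VQ 0; rewrite !rmorph0 horner0.
rewrite rmorphD rmorphM /= map_polyX map_polyC /= hornerMXaddC.
by apply: VD => //; apply: VM.
Qed.

Lemma zeta_root4 : zeta_root R 4 = 'i%C.
Proof.
rewrite /zeta_root; have -> : 2 * pi / 4%:R = pi / 2%:R :> R by field.
by rewrite cos_pihalf sin_pihalf.
Qed.

Lemma subfield_rat (G : set C) r : subfield G -> G (ratr r).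
Proof.
rewrite /subfield => -[G1 GB Gdiv]; rewrite !inE in G1.
have GB' x y : G x -> G y -> G (x - y).
  by have := GB x y; rewrite !inE.
have Gdiv' x y : G x -> G y -> G (x / y).
  by have := Gdiv x y; rewrite !inE.
have G0 : G 0 by rewrite -(subrr 1); apply: GB'.
have GN x : G x -> G (- x) by rewrite -sub0r; apply: GB'.
have Gnat n : G n%:R.
  elim: n => // n IH; rewrite -natr1 -[X in _ + X]opprK.
  by apply: GB' => //; apply: GN.
have Gint (m : int) : G m%:~R.
  case: m => n; first exact: Gnat.
  by rewrite NegzE mulrNz; apply: GN; apply: Gnat.
by apply: Gdiv'.
Qed.

Lemma real_cap_Qi (F : set C) : (forall r : rat, F (ratr r)) ->
  F `<=` range (fun x : R => x%:C) -> F `&` Qadjoin (zeta_root R 4) = Qset R.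
Proof.
move=> QF Freal; rewrite zeta_root4; apply/seteqP; split; last first.
  move=> _ [r _ <-]; split => // G [Gsub _]; exact: subfield_rat.
(* The Gaussian rationals form a subfield containing i, hence contain [Qadjoin]; a real one equals
   its rational real part. *)
pose G := [set x : C | exists a b : rat, x = ratr a + ratr b * 'i%C].
have ratE (r : rat) : ratC r = (ratr r : R)%:C.
  by rewrite -[RHS]/(real_complex R _) fmorph_rat.
have GE (a b : rat) : ratC a + ratC b * 'i%C = (ratr a : R) +i* (ratr b : R).
  by rewrite !ratE; simpc.
have Gi : subfield G.
  split; first by rewrite inE; exists 1, 0; rewrite rmorph1 rmorph0 mul0r addr0.
    move=> x y; rewrite !inE => -[a [b ->]] [c [e ->]].
    by exists (a - c), (b - e); rewrite !rmorphB /=; ring.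
  move=> x y; rewrite !inE => -[a [b ->]] [c [e ->]].
  (* Multiplication by the conjugate; for c = e = 0 the quotient and the witness are both 0 because
     0^-1 = 0. *)
  exists ((a * c + b * e) / (c ^+ 2 + e ^+ 2)),
    ((b * c - a * e) / (c ^+ 2 + e ^+ 2)).
  rewrite !GE; simpc.
  by rewrite ?(rmorphM, rmorphD, rmorphB, fmorphV, rmorphXn) /=; congr (_ +i* _); ring.
move=> _ [/Freal [x _ <-] /(_ G)[]].
  by split => // _ ->; exists 0, 1; rewrite rmorph0 rmorph1 mul1r add0r.
move=> a [b xE]; exists a => //; move: xE; rewrite GE => -[-> _].
exact: ratE.
Qed.
End NumberFields.

(** * Symmetric sums over an arithmetic progression *)

Section PowerSums.
Variable F : fieldType.

(* Partial fractions; the diagonal terms of the inner sum vanish because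
   [0^-1 = 0]. *)
Lemma power_sum_convolution (I : finType) (e y : I -> F) (m : nat) :
  (forall i, e i ^+ 2 = 1) -> (forall i, y i != 0) -> injective y ->
  let q s := \sum_i e i * (y i)^-1 ^+ s in
  \sum_(a < m.+1) q a.+1 * q (m.+1 - a)%N =
    m.+1%:R * \sum_i (y i)^-1 ^+ m.+2 +
    2 * \sum_j e j * (y j)^-1 ^+ m.+1 * \sum_i e i * (y i - y j)^-1.
Proof.
move=> e2 y0 yinj q; set u := fun i => (y i)^-1.
pose k i j := e i * e j * (y i - y j)^-1.
have kN i j : k i j = - k j i by rewrite /k [e j * _]mulrC -opprB invrN mulrN.
(* On the diagonal the [m.+1] summands coincide; off it they form a geometric sum, and [u j - u i]
   is [(y i - y j) * (u i * u j)]. *)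
have term i j : \sum_(a < m.+1) (e i * u i ^+ a.+1) * (e j * u j ^+ (m.+1 - a)) =
    (if i == j then m.+1%:R * u i ^+ m.+2 else 0) +
    (u j ^+ m.+1 - u i ^+ m.+1) * k i j.
  have -> : \sum_(a < m.+1) (e i * u i ^+ a.+1) * (e j * u j ^+ (m.+1 - a)) =
      e i * e j * (u i * u j * \sum_(a < m.+1) u j ^+ (m - a) * u i ^+ a).
    rewrite !mulr_sumr; apply: eq_bigr => a _.
    have am : (a <= m)%N by rewrite -ltnS.
    rewrite (subSn am) 2!exprS.
    by ring.
  case: eqVneq => [<-|neq_ij].
    rewrite subrr mul0r addr0 -expr2 e2 mul1r.
    rewrite (eq_bigr (fun=> u i ^+ m)); last first.
      by move=> a _; rewrite -exprD subnK // -ltnS.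
    by rewrite sumr_const card_ord -[u i ^+ m *+ _]mulr_natl !exprS; ring.
  have yij : y i - y j != 0 by rewrite subr_eq0 (inj_eq yinj).
  rewrite add0r subrXX /= /k /u.
  have -> : (y j)^-1 - (y i)^-1 = (y i - y j) * ((y i)^-1 * (y j)^-1).
    by field; rewrite ?y0.
  move: (\sum_(i0 < m.+1) _) => S.
  by rewrite -!mulrA; field; rewrite ?y0 ?yij.
have -> : \sum_(a < m.+1) q a.+1 * q (m.+1 - a)%N = \sum_i \sum_j
    \sum_(a < m.+1) (e i * u i ^+ a.+1) * (e j * u j ^+ (m.+1 - a)).
  under eq_bigr do rewrite big_distrlr.
  rewrite exchange_big; apply: eq_bigr => i _ /=.
  by rewrite exchange_big.
under eq_bigr do under eq_bigr do rewrite term.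
under eq_bigr do rewrite big_split.
rewrite big_split /=; congr (_ + _).
  rewrite mulr_sumr; apply: eq_bigr => i _.
  by under eq_bigr do rewrite eq_sym; rewrite -big_mkcond big_pred1_eq.
under eq_bigr do under eq_bigr do rewrite mulrBl.
under eq_bigr do rewrite sumrB.
(* Exchanging i and j and using the antisymmetry of [k] makes the two halves equal, whence the
   factor 2. *)
rewrite sumrB exchange_big /= mulr2n mulrDl mul1r; congr (_ + _).
  apply: eq_bigr => j _; rewrite mulr_sumr; apply: eq_bigr => i _.
  by rewrite /k; ring.
rewrite -sumrN; apply: eq_bigr => j _; rewrite mulr_sumr -sumrN.
by apply: eq_bigr => i _; rewrite kN /k; ring.
Qed.

End PowerSums.

(** * Harmonic sums and bounds for the error term *)

Section Estimates.
Variable R : realType.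
Implicit Types (e : R) (n m r t N : nat).

Definition twisted_harmonic e n : R := \sum_(0 <= l < n) e ^+ l.+1 / l.+1%:R.

(** Since [e ^+ 2 = 1], [e ^+ j * e ^+ i] depends only on |i - j|. The [r] indices above [j] give
    one harmonic sum, the [j] indices below it the other with opposite sign, and i = j contributes 0
    because 0^-1 = 0. *)
Lemma twisted_harmonicE e j r : e ^+ 2 = 1 ->
  e ^+ j * \sum_(0 <= i < j + r.+1) e ^+ i * (i%:R - j%:R)^-1 =
  twisted_harmonic e r - twisted_harmonic e j.
Proof.
move=> e2; elim: j => [|j IH].
  rewrite add0n mul1r [in RHS]/twisted_harmonic big_nil subr0 big_nat_recl //.
  rewrite subrr invr0 mulr0 add0r; apply: eq_big_nat => l _.
  by rewrite subr0.
rewrite addSn big_nat_recl // mulrDr mulr0n sub0r mul1r.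
rewrite {2}/twisted_harmonic big_nat_recr //= -/(twisted_harmonic e j).
have shift i : i.+1%:R - j.+1%:R = i%:R - j%:R :> R by rewrite -!natr1; ring.
under eq_bigr do rewrite shift.
have -> : e ^+ j.+1 * (\sum_(0 <= i < j + r.+1) e ^+ i.+1 * (i%:R - j%:R)^-1) =
    e ^+ j * \sum_(0 <= i < j + r.+1) e ^+ i * (i%:R - j%:R)^-1.
  rewrite !mulr_sumr; apply: eq_bigr => i _.
  transitivity (e ^+ 2 * (e ^+ j * (e ^+ i * (i%:R - j%:R)^-1))).
    by move: (_^-1) => w; rewrite !exprS expr0; ring.
  by rewrite e2 mul1r.
by rewrite IH invrN mulrN; ring.
Qed.

Lemma twisted_harmonicB e n r :
  twisted_harmonic e (n + r) - twisted_harmonic e n =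
  \sum_(0 <= l < r) e ^+ (n + l.+1) / (n + l.+1)%:R.
Proof.
elim: r => [|r IH]; first by rewrite addn0 subrr big_nil.
rewrite addnS [twisted_harmonic e _.+1]big_nat_recr //=.
by rewrite -/(twisted_harmonic _ _) [RHS]big_nat_recr //= -IH addnS addrAC.
Qed.

Lemma harmonic_gap n r :
  `|twisted_harmonic 1 (n + r) - twisted_harmonic 1 n| <= r%:R / n.+1%:R.
Proof.
rewrite twisted_harmonicB (le_trans (ler_norm_sum _ _ _)) //.
rewrite (le_trans (y := \sum_(0 <= l < r) n.+1%:R^-1)) //; last first.
  by rewrite sumr_const_nat subn0 mulr_natl.
apply: ler_sum => l _; rewrite expr1n mul1r ger0_norm // lef_pV2 ?posrE ?ltr0n //.
  by rewrite ler_nat addnS ltnS leq_addr.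
by rewrite addnS.
Qed.

(** Removing the first term leaves minus a tail of the same kind, which by induction lies between 0
    and the next term. *)
Lemma alternating_tail n r :
  0 <= \sum_(0 <= l < r) ((-1) ^+ l / (n + l.+1)%:R : R) <= n.+1%:R^-1.
Proof.
elim: r n => [|r IH] n; first by rewrite big_nil lexx /= invr_ge0.
rewrite big_nat_recl // expr0 mul1r addn1.
have -> : \sum_(0 <= i < r) (-1) ^+ i.+1 / (n + i.+2)%:R =
    - \sum_(0 <= i < r) (-1) ^+ i / (n.+1 + i.+1)%:R :> R.
  by rewrite -sumrN; apply: eq_bigr => i _; rewrite exprS addSnnS; ring.
have /andP[lo hi] := IH n.+1.
rewrite subr_ge0 gerBl lo andbT (le_trans hi) //.
by rewrite lef_pV2 ?posrE ?ltr0n // ler_nat.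
Qed.

(** Unlike in [harmonic_gap], there is no factor [r]; this gain pays for the weaker decay at
    exponent 1. *)
Lemma alternating_gap n r :
  `|twisted_harmonic (-1) (n + r) - twisted_harmonic (-1) n| <= n.+1%:R^-1.
Proof.
rewrite twisted_harmonicB.
under eq_bigr do rewrite addnS -addSn exprD -mulrA addSn -addnS.
rewrite -mulr_sumr normrM normrX normrN1 expr1n mul1r.
by have /andP[lo hi] := alternating_tail n r; rewrite ger0_norm.
Qed.

Definition error_bound N : R := \sum_(t < N) (t.+1%:R * (N - t)%:R)^-1.

Lemma error_bound_cvg : error_bound @ \oo --> 0.
Proof.
have le N : error_bound N <= 2 * arithmetic_mean harmonic N.
  (* Partial fractions with (t+1) + (N-t) = N+1; reversing t identifies the two resulting sums. *)
  have -> : error_bound N = N.+1%:R^-1 * (2 * \sum_(t < N) t.+1%:R^-1).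
    have -> : 2 * \sum_(t < N) (t.+1%:R : R)^-1 =
        \sum_(t < N) (t.+1%:R^-1 + (N - t)%:R^-1).
      rewrite mulr2n mulrDl mul1r big_split /=; congr (_ + _).
      rewrite (reindex_inj rev_ord_inj) /=; apply: eq_bigr => t _.
      by rewrite subnSK.
    rewrite mulr_sumr; apply: eq_bigr => t _.
    have Nt0 : (N - t)%:R != 0 :> R by rewrite pnatr_eq0 subn_eq0 -ltnNge.
    have -> : N.+1%:R = t.+1%:R + (N - t)%:R :> R.
      by rewrite -natrD addSn subnKC // ltnW.
    have t0 : t.+1%:R + (N - t)%:R != 0 :> R by rewrite -natrD addSn pnatr_eq0.
    have : t.+1%:R != 0 :> R by rewrite pnatr_eq0.
    move: t.+1%:R (N - t)%:R Nt0 t0 => a b b0 ab0 a0.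
    by field; apply/and3P.
  (* The mean runs over [N.+1] terms, one more than the sum; the extra one is nonnegative. *)
  rewrite /arithmetic_mean /= mulrCA ler_wpM2l // ler_wpM2l // /series /=.
  by rewrite big_nat_recr //= big_mkord lerDl.
have bound0 N : 0 <= error_bound N by apply: sumr_ge0 => t _.
apply: (@squeeze_cvgr _ _ _ _ (cst 0) (fun N => 2 * arithmetic_mean harmonic N)).
- by apply: nearW => N; rewrite bound0 le.
- exact: cvg_cst.
- rewrite -[X in _ --> X](mulr0 2); apply: cvgM; first exact: cvg_cst.
  exact/cesaro/cvg_harmonic.
Unshelve. all: by end_near.
Qed.

End Estimates.

(** * Truncated power sums over the progression c n + 1 *)

Section TwistedSums.
Variable R : realType.
Implicit Types (c e : R) (m n N s t : nat).

(** The indices j < 2N stand for the integers n = j - N from -N to N - 1. *)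
Definition node c N (j : nat) : R := c * (j%:R - N%:R) + 1.

(* For c = 4, e = 1 these are the partial sums of P(s), indexed by the residue
   class 1 mod 4; c = 2, e = -1 gives the alternating sums needed for P(2). *)
Definition twisted_sum c e N s : R :=
  \sum_(j < N + N) e ^+ j * (node c N j)^-1 ^+ s.

(** The error term of [power_sum_convolution] at these nodes, up to its factor 2. *)
Definition twisted_error c e N m : R :=
  \sum_(j < N + N) e ^+ j * (node c N j)^-1 ^+ m.+1 *
    \sum_(i < N + N) e ^+ i * (node c N i - node c N j)^-1.

Lemma node_rshift c N t : node c N (N + t) = c * t%:R + 1.
Proof. by rewrite /node natrD; ring. Qed.

Lemma node_lshift c N t : (t < N)%N -> node c N (N - t.+1) = - (c * t.+1%:R - 1).
Proof. by move=> tN; rewrite /node natrB //; ring. Qed.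

Lemma sum_nodes (V : nmodType) (f : nat -> V) N :
  \sum_(j < N + N) f j = \sum_(t < N) (f (N + t)%N + f (N - t.+1)%N).
Proof.
rewrite big_split_ord /= addrC big_split /=; congr (_ + _).
by rewrite (reindex_inj rev_ord_inj).
Qed.

(** The nodes of index N+t and N-t-1 have their numbers of larger and smaller indices exchanged, so
    by [twisted_harmonicE] their inner sums are opposite. *)
Lemma twisted_errorE c e N m : e ^+ 2 = 1 ->
  twisted_error c e N m = c^-1 * \sum_(t < N)
    (((node c N (N - t.+1))^-1 ^+ m.+1 - (node c N (N + t))^-1 ^+ m.+1) *
    (twisted_harmonic e (N + t) - twisted_harmonic e (N - t.+1))).
Proof.
move=> e2; have inner j r : (j + r.+1 = N + N)%N ->
    e ^+ j * (\sum_(i < N + N) e ^+ i * (node c N i - node c N j)^-1) =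
    c^-1 * (twisted_harmonic e r - twisted_harmonic e j).
  move=> <-; rewrite -(twisted_harmonicE _ _ e2) mulrCA; congr (_ * _).
  rewrite big_mkord mulr_sumr; apply: eq_bigr => i _.
  have -> : node c N i - node c N j = c * (i%:R - j%:R) by rewrite /node; ring.
  by rewrite invfM mulrCA.
rewrite /twisted_error.
under eq_bigr do rewrite mulrAC.
rewrite (sum_nodes (fun j => e ^+ j *
  (\sum_(i < N + N) e ^+ i * (node c N i - node c N j)^-1) *
  (node c N j)^-1 ^+ m.+1)) mulr_sumr.
apply: eq_bigr => t _.
have tN := ltn_ord t.
rewrite (inner (N + t)%N (N - t.+1)%N); last by lia.
rewrite (inner (N - t.+1)%N (N + t)%N); last by lia.
by ring.
Qed.

Lemma twisted_error_cvg c e m : e ^+ 2 = 1 ->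
  (forall N t, (t < N)%N ->
     `|(node c N (N - t.+1))^-1 ^+ m.+1 - (node c N (N + t))^-1 ^+ m.+1| *
     `|twisted_harmonic e (N + t) - twisted_harmonic e (N - t.+1)| <=
     2 * (t.+1%:R * (N - t)%:R)^-1) ->
  twisted_error c e ^~ m @ \oo --> 0.
Proof.
move=> e2 term; apply/norm_cvg0P.
apply: (@squeeze_cvgr _ _ _ _ (cst 0) (fun N => `|c^-1| * (2 * error_bound R N))).
- apply: nearW => N; rewrite normr_ge0 /= twisted_errorE // normrM ler_wpM2l //.
  rewrite (le_trans (ler_norm_sum _ _ _)) // mulr_sumr.
  by apply: ler_sum => t _; rewrite normrM term.
- exact: cvg_cst.
- rewrite -[X in _ --> X](mulr0 `|c^-1|); apply: cvgM; first exact: cvg_cst.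
  rewrite -[X in _ --> X](mulr0 2); apply: cvgM; first exact: cvg_cst.
  exact: error_bound_cvg.
Unshelve. all: by end_near.
Qed.

(** The exponent is at least 2, and quadratic decay of the node powers absorbs the [2 * t + 1] terms
    of the harmonic gap. *)
Lemma twisted_error_cvg4 m : twisted_error 4 1 ^~ m.+1 @ \oo --> 0.
Proof.
apply: twisted_error_cvg => [|N t tN]; first by rewrite expr1n.
rewrite node_rshift node_lshift //.
have -> : (N + t = N - t.+1 + (2 * t + 1))%N by lia.
have gap := @harmonic_gap R (N - t.+1) (2 * t + 1).
rewrite subnSK // in gap.
set u := (- (4 * t.+1%:R - 1))^-1; set v := (4 * t%:R + 1)^-1.
have t0 : 0 <= t%:R :> R by [].
have t1 : t.+1%:R = t%:R + 1 :> R by rewrite natr1.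
have bound (w : R) : `|w| <= (4 * t%:R + 1)^-1 ->
    `|w ^+ m.+2| <= (4 * t%:R + 1)^-1 ^+ 2.
  move=> le; rewrite normrX (le_trans (y := (4 * t%:R + 1)^-1 ^+ m.+2)) //.
    by rewrite lerXn2r ?nnegrE //; lra.
  have v0 : 0 <= (4 * t%:R + 1)^-1 :> R by rewrite invr_ge0; lra.
  have v1 : (4 * t%:R + 1)^-1 <= 1 :> R by rewrite invf_le1; lra.
  exact: ler_wiXn2l.
have ub : `|u| <= (4 * t%:R + 1)^-1.
  rewrite /u invrN normrN normfV ger0_norm; last by lra.
  by rewrite lef_pV2 ?posrE; lra.
have vb : `|v| <= (4 * t%:R + 1)^-1.
  by rewrite /v normfV ger0_norm; lra.
have := le_trans (ler_normB _ _) (lerD (bound _ ub) (bound _ vb)).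
move=> uvb; rewrite (le_trans (ler_pM _ _ uvb gap)) //.
have Nt0 : 0 < (N - t)%:R :> R by rewrite ltr0n subn_gt0.
have inv0 : 0 <= (N - t)%:R^-1 :> R by rewrite invr_ge0 ltW.
rewrite t1 invfM natrD natrM !mulrA ler_wpM2r //.
have : (4 * t%:R + 1)^-1 ^+ 2 * (2 * t%:R + 1) <= (t%:R + 1)^-1 :> R.
  rewrite exprVn mulrC ler_pdivrMr; last by rewrite exprn_gt0; lra.
  rewrite [leRHS]mulrC ler_pdivlMr; last by lra.
  by nra.
by rewrite mulrDl; lra.
Qed.

(** The paired nodes are exactly opposite, with inverses of size 1/(2t+1); the alternating gap
    supplies the remaining 1/(N-t). *)
Lemma twisted_error_cvg2 : twisted_error 2 (-1) ^~ 0 @ \oo --> 0.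
Proof.
apply: twisted_error_cvg => [|N t tN]; first by rewrite sqrrN expr1n.
rewrite node_rshift node_lshift // !expr1.
have -> : (N + t = N - t.+1 + (2 * t + 1))%N by lia.
have gap := @alternating_gap R (N - t.+1) (2 * t + 1).
rewrite subnSK // in gap.
have t0 : 0 <= t%:R :> R by [].
have t1 : t.+1%:R = t%:R + 1 :> R by rewrite natr1.
have -> : (- (2 * t.+1%:R - 1))^-1 - (2 * t%:R + 1)^-1 = - (2 * (2 * t%:R + 1)^-1) :> R.
  have -> : - (2 * t.+1%:R - 1) = - (2 * t%:R + 1) :> R by rewrite t1; ring.
  by rewrite invrN; ring.
rewrite normrN ger0_norm; last by rewrite mulr_ge0 // invr_ge0; lra.
rewrite invfM -mulrA ler_wpM2l //; apply: ler_pM => //.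
by rewrite t1 lef_pV2 ?posrE; lra.
Qed.

End TwistedSums.

(** * Rationality of P(s) / P(1)^s *)

Section PeriodRatios.
Variable R : realType.
Implicit Types (N s t k : nat).

(** The integers n = t and n = -t-1 are paired, because for s = 1 neither half converges alone. *)
Definition quarter_term s t : R :=
  (4 * t%:R + 1)^-1 ^+ s + (- (4 * t%:R + 3))^-1 ^+ s.

(* The sum of [(4 n + 1) ^- s] over all integers [n], taken symmetrically. *)
Definition quarter_sum s : R := limn (series (quarter_term s)).

Lemma inv_square_series_cvg : cvgn (series (fun t => (t.+1%:R ^- 2 : R))).
Proof.
apply: nondecreasing_is_cvgn.
  by apply: nondecreasing_series => t _ _; rewrite invr_ge0 exprn_ge0.
(* The bound 1/(a+1)^2 <= 1/a - 1/(a+1) telescopes. *)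
have le N : series (fun t => (t.+1%:R ^- 2 : R)) N.+1 <= 2 - N.+1%:R^-1.
  elim: N => [|N IH].
    by rewrite /series /= big_nat1 expr1n invr1; lra.
  rewrite seriesSr (le_trans (lerD IH (lexx _))) //.
  have a0 : 0 < N.+1%:R :> R by [].
  have -> : N.+2%:R = N.+1%:R + 1 :> R by rewrite natr1.
  move: N.+1%:R a0 => a a0.
  have : (a + 1) ^- 2 <= (a * (a + 1))^-1.
    by rewrite lef_pV2 ?posrE ?exprn_gt0 ?mulr_gt0 //; nra.
  have -> : (a * (a + 1))^-1 = a^-1 - (a + 1)^-1.
    by field; apply/andP; split; apply: lt0r_neq0; lra.
  by lra.
exists 2 => _ [[|N] _ <-]; first by rewrite /series /= big_geq.
by rewrite (le_trans (le N)) // gerBl invr_ge0.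
Qed.

(** For s = 1 cancellation within the pair leaves 2/((4t+1)(4t+3)); for s >= 2 each term alone is
    small enough. *)
Lemma quarter_term_le s t : (0 < s)%N -> `|quarter_term s t| <= 2 * t.+1%:R ^- 2.
Proof.
have t0 : 0 <= t%:R :> R by [].
have t1 : t.+1%:R = t%:R + 1 :> R by rewrite natr1.
have T0 : 0 < t.+1%:R :> R by [].
case: s => [//|[_|s _]]; rewrite /quarter_term.
  rewrite !expr1 invrN.
  have -> : (4 * t%:R + 1)^-1 - (4 * t%:R + 3)^-1 =
      2 * ((4 * t%:R + 1) * (4 * t%:R + 3))^-1 :> R.
    by field; apply/andP; split; apply: lt0r_neq0; lra.
  rewrite ger0_norm; last first.
    by rewrite mulr_ge0 // invr_ge0 mulr_ge0 //; lra.
  rewrite ler_wpM2l // lef_pV2 ?posrE ?exprn_gt0 ?mulr_gt0 //; try lra.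
  by rewrite t1; nra.
have bound (w : R) : t.+1%:R <= `|w| -> `|w^-1 ^+ s.+2| <= t.+1%:R ^- 2.
  move=> le; rewrite normrX normfV exprVn lef_pV2 ?posrE ?exprn_gt0 //; last first.
    exact: lt_le_trans le.
  rewrite (le_trans (y := t.+1%:R ^+ s.+2)) //; last first.
    by rewrite lerXn2r ?nnegrE.
  by rewrite ler_weXn2l // ler1n.
rewrite (le_trans (ler_normD _ _)) //.
have -> : 2 * t.+1%:R ^- 2 = t.+1%:R ^- 2 + t.+1%:R ^- 2 :> R by ring.
apply: lerD; apply: bound.
  by rewrite ger0_norm; lra.
by rewrite normrN ger0_norm; lra.
Qed.

Lemma quarter_series_cvg s : (0 < s)%N -> series (quarter_term s) @ \oo --> quarter_sum s.
Proof.
move=> s0; apply: normed_cvg.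
apply: (@series_le_cvg _ (fun t => `|quarter_term s t|) (fun t => 2 * t.+1%:R ^- 2)).
- by move=> t; apply: normr_ge0.
- by move=> t; rewrite mulr_ge0 // invr_ge0 exprn_ge0.
- by move=> t; apply: quarter_term_le.
- apply: (@is_cvg_seriesZ _ (fun t => t.+1%:R ^- 2) 2); exact: inv_square_series_cvg.
Qed.

Lemma twisted_sum4 N s : twisted_sum 4 1 N s = series (quarter_term s) N.
Proof.
rewrite /twisted_sum (sum_nodes (fun j => 1 ^+ j * (node 4 N j)^-1 ^+ s)).
rewrite /series /= big_mkord; apply: eq_bigr => t _.
rewrite !expr1n !mul1r node_rshift node_lshift // /quarter_term; congr (_ + _^-1 ^+ _).
by rewrite -natr1; ring.
Qed.

Lemma series_pair (V : zmodType) (f : nat -> V) N :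
  series f N.*2 = series (fun t => f t.*2 + f t.*2.+1) N.
Proof.
elim: N => [|N IH]; first by rewrite /series /= !big_geq.
by rewrite doubleS !seriesS IH /= addrCA -addrA addrCA.
Qed.

(** Each (-1)^n/(2n+1) is 1/m, where m is whichever of 2n+1 and -(2n+1) is 1 mod 4, and every such m
    arises twice. The even truncation [N.*2] keeps the sign [(-1) ^+ j] equal to (-1)^n. *)
Lemma twisted_sum2 N :
  twisted_sum 2 (-1) N.*2 1 = 2 * series (quarter_term 1) N.
Proof.
rewrite /twisted_sum (sum_nodes (fun j => (-1) ^+ j * (node 2 N.*2 j)^-1 ^+ 1)).
transitivity (2 * series (fun t => (-1) ^+ t * (2 * t%:R + 1)^-1 : R) N.*2).
  rewrite /series /= big_mkord mulr_sumr; apply: eq_bigr => t _.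
  have -> : ((-1) ^+ (N.*2 - t.+1) = - (-1) ^+ t :> R).
    by rewrite -signr_odd oddB // odd_double /= signrN signr_odd.
  rewrite !expr1 node_rshift node_lshift // exprD -signr_odd odd_double mul1r.
  have -> : 2 * t.+1%:R - 1 = 2 * t%:R + 1 :> R by rewrite -natr1; ring.
  by rewrite invrN; ring.
rewrite series_pair; congr (2 * _); apply: eq_bigr => t _.
rewrite exprS -signr_odd odd_double expr0 mulr1 mul1r mulN1r.
rewrite /quarter_term !expr1 invrN -natr1 -muln2 natrM.
by congr (_ ^-1 - _^-1); ring.
Qed.

Lemma square_nodes2 N :
  \sum_(j < N.*2 + N.*2) (node 2 N.*2 j)^-1 ^+ 2 = 2 * series (quarter_term 2) N.
Proof.
rewrite (sum_nodes (fun j => (node 2 N.*2 j)^-1 ^+ 2)).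
transitivity (2 * series (fun t => (2 * t%:R + 1)^-1 ^+ 2 : R) N.*2).
  rewrite /series /= big_mkord mulr_sumr; apply: eq_bigr => t _.
  rewrite node_rshift node_lshift //.
  have -> : 2 * t.+1%:R - 1 = 2 * t%:R + 1 :> R by rewrite -natr1; ring.
  by rewrite invrN; ring.
rewrite series_pair; congr (2 * _); apply: eq_bigr => t _.
rewrite /quarter_term invrN sqrrN -natr1 -muln2 natrM.
by congr (_ ^-1 ^+ _ + _^-1 ^+ _); ring.
Qed.

Lemma node_inj c N : c != 0 -> injective (fun j : 'I_(N + N) => node c N j : R).
Proof.
move=> c0 i j /addIr /(mulfI c0) /addIr /eqP; rewrite eqr_nat => /eqP.
exact: val_inj.
Qed.

(** A zero node would make [c] divide -1 in the integers. *)
Lemma node_neq0 c N j : (1 < c)%N -> node c%:R N j != 0 :> R.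
Proof.
move=> c1; rewrite /node; apply/eqP => /eqP.
rewrite addr_eq0 -[c%:R]/(c%:~R) -[j%:R]/(j%:~R) -[N%:R]/(N%:~R) -rmorphB -rmorphM /=.
rewrite -(mulrN1z 1) eqr_int => /eqP cE.
have : (c %| (- 1%:Z)%R)%Z by rewrite -cE dvdz_mulr.
by rewrite dvdzE /= dvdn1; case: eqP c1 => // ->.
Qed.

(** The limit of [power_sum_convolution] with all signs 1; starting at P(3) keeps the exponent in
    the error at least 2, as [twisted_error_cvg4] requires. *)
Lemma quarter_sum_convolution m :
  \sum_(a < m.+2) quarter_sum a.+1 * quarter_sum (m.+2 - a)%N =
  m.+2%:R * quarter_sum m.+3.
Proof.
have id N : \sum_(a < m.+2) series (quarter_term a.+1) N * series (quarter_term (m.+2 - a)) N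
    = m.+2%:R * series (quarter_term m.+3) N + 2 * twisted_error 4 1 N m.+1.
  under eq_bigr do rewrite -!twisted_sum4.
  rewrite /twisted_sum (power_sum_convolution (e := fun j : 'I_(N + N) => 1 ^+ j)).
  - congr (_ * _ + _); rewrite -twisted_sum4; apply: eq_bigr => j _.
    by rewrite expr1n mul1r.
  - by move=> j; rewrite !expr1n.
  - by move=> j; apply: (@node_neq0 4).
  - exact: node_inj.
have lhs : (fun N => \sum_(a < m.+2) series (quarter_term a.+1) N *
      series (quarter_term (m.+2 - a)) N) @ \oo -->
    \sum_(a < m.+2) quarter_sum a.+1 * quarter_sum (m.+2 - a)%N.
  apply: cvg_big => [|a _]; first exact: add_continuous.
  apply: cvgM; apply: quarter_series_cvg => //.
  by rewrite subn_gt0.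
have rhs : (fun N => m.+2%:R * series (quarter_term m.+3) N +
    2 * twisted_error 4 1 N m.+1) @ \oo --> m.+2%:R * quarter_sum m.+3 + 2 * 0.
  apply: cvgD; apply: cvgM; [exact: cvg_cst|exact: quarter_series_cvg|exact: cvg_cst|].
  exact: twisted_error_cvg4.
rewrite -(funext id) mulr0 addr0 in rhs.
exact: (cvg_unique _ lhs rhs).
Qed.

Lemma cvg_double (u : nat -> R) (l : R) : u @ \oo --> l ->
  (fun n => u n.*2) @ \oo --> l.
Proof.
apply: cvg_comp => A [M _ MA]; exists M => // n /= Mn; apply: MA => /=; lia.
Qed.

(** The limit of the case [m = 0] with alternating signs: they square to 1 on the diagonal, so P(2)
    appears without signs. *)
Lemma quarter_sum2 : quarter_sum 2 = 2 * quarter_sum 1 ^+ 2.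
Proof.
have id N : (2 * series (quarter_term 1) N) ^+ 2 =
    2 * series (quarter_term 2) N + 2 * twisted_error 2 (-1) N.*2 0.
  have e2 (j : 'I_(N.*2 + N.*2)) : ((-1) ^+ j : R) ^+ 2 = 1 by rewrite sqrr_sign.
  have y0 (j : 'I_(N.*2 + N.*2)) : node 2 N.*2 j != 0 :> R by exact: (@node_neq0 2).
  have yinj : injective (fun j : 'I_(N.*2 + N.*2) => node 2 N.*2 j : R).
    exact: node_inj.
  have := power_sum_convolution 0 e2 y0 yinj.
  by rewrite /= big_ord1 -/(twisted_sum _ _ _ _) twisted_sum2 square_nodes2 mul1r -expr2.
have lhs : (fun N => (2 * series (quarter_term 1) N) ^+ 2) @ \oo -->
    (2 * quarter_sum 1) ^+ 2.
  rewrite expr2; under eq_fun do rewrite expr2.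
  by apply: cvgM; (apply: cvgM; [exact: cvg_cst|exact: quarter_series_cvg]).
have rhs : (fun N => 2 * series (quarter_term 2) N +
    2 * twisted_error 2 (-1) N.*2 0) @ \oo -->
    2 * quarter_sum 2 + 2 * 0.
  apply: cvgD; apply: cvgM; [exact: cvg_cst|exact: quarter_series_cvg|exact: cvg_cst|].
  exact: (@cvg_double (fun N => twisted_error 2 (-1) N 0) _ (@twisted_error_cvg2 R)).
rewrite -(funext id) mulr0 addr0 in rhs.
have eq2 : (2 * quarter_sum 1) ^+ 2 = 2 * quarter_sum 2.
  exact: (cvg_unique _ lhs rhs).
have two0 : 2 != 0 :> R by [].
by apply: (mulfI two0); rewrite -eq2; ring.
Qed.

Lemma quarter_sum_rational s : (0 < s)%N ->
  exists r : rat, quarter_sum s = ratr r * quarter_sum 1 ^+ s.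
Proof.
elim/ltn_ind: s => -[//|[|[|m]]] IH _.
- by exists 1; rewrite rmorph1 mul1r expr1.
- by exists 2; rewrite quarter_sum2 rmorph_nat.
(* With the range condition inside the existential, [choice] gives one coefficient function on all
   of nat; 0 is a dummy value outside the range. *)
have {}IH s : exists r : rat, (0 < s < m.+3)%N ->
    quarter_sum s = ratr r * quarter_sum 1 ^+ s.
  have [/andP[s0 sm]|] := boolP (0 < s < m.+3)%N; last by exists 0.
  by have [r ->] := IH s sm s0; exists r.
have [r rE] := choice IH.
exists (m.+2%:R^-1 * \sum_(a < m.+2) r a.+1 * r (m.+2 - a)%N).
have m0 : m.+2%:R != 0 :> R by rewrite pnatr_eq0.
apply: (mulfI m0); rewrite -quarter_sum_convolution.
rewrite rmorphM fmorphV rmorph_nat mulrA mulVKf // rmorph_sum mulr_suml.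
apply: eq_bigr => a _; have am := ltn_ord a.
rewrite (rE a.+1) ?(rE (m.+2 - a)%N); [|by lia|by lia].
by rewrite rmorphM mulrACA -exprD; congr (_ * _ ^+ _); lia.
Qed.

End PeriodRatios.

(** * Zeta values *)

Section ZetaValues.
Variable R : realType.
Implicit Types (n k s : nat).

Lemma zeta_series_cvg k : (1 < k)%N ->
  series (fun n => (n%:R + 1) ^- k) @ \oo --> hurwitz_zeta k (1 : R).
Proof.
move=> k1; apply: (@series_le_cvg _ _ (fun n => n.+1%:R ^- 2)).
- by move=> n; rewrite invr_ge0 exprn_ge0 // addr_ge0.
- by move=> n; rewrite invr_ge0 exprn_ge0.
- move=> n; rewrite natr1 lef_pV2 ?posrE ?exprn_gt0 //.
  by rewrite ler_weXn2l // ler1n.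
- exact: inv_square_series_cvg.
Qed.

Lemma zeta_gt0 k : (1 < k)%N -> 0 < hurwitz_zeta k (1 : R).
Proof.
move=> k1; apply: (@lt_le_trans _ _ (series (fun n => (n%:R + 1 : R) ^- k) 1)).
  by rewrite /series /= big_nat1 add0r expr1n invr1.
apply: nondecreasing_cvgn_le; last exact/cvgP/zeta_series_cvg.
by apply: nondecreasing_series => n _ _; rewrite invr_ge0 exprn_ge0 // addr_ge0.
Qed.

(* Splitting the zeta series according to the parity of the summation index. *)
Lemma odd_zeta_cvg k : (1 < k)%N ->
  series (fun n => (2 * n%:R + 1 : R) ^- k) @ \oo -->
    (1 - 2 ^- k) * hurwitz_zeta k (1 : R).
Proof.
move=> k1; have cv := zeta_series_cvg k1.
have -> : series (fun n => (2 * n%:R + 1 : R) ^- k) =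
    (fun N => series (fun n => (n%:R + 1) ^- k) N.*2 -
              2 ^- k * series (fun n => (n%:R + 1) ^- k) N).
  apply/funext => N; rewrite series_pair /series /= mulr_sumr -sumrB.
  apply: eq_bigr => n _; rewrite -muln2 -[(n * 2).+1%:R]natr1 natrM.
  have -> : n%:R * 2%:R + 1 + 1 = 2 * (n%:R + 1) :> R by ring.
  by rewrite exprMn invfM addrK mulrC.
rewrite mulrBl mul1r; apply: cvgB; first exact: cvg_double.
by apply: cvgM => //; exact: cvg_cst.
Qed.

(** Even powers forget signs, so the nodes 4t+1 and -(4t+3) account for all odd positive
    integers. *)
Lemma quarter_sum_even k : (0 < k)%N ->
  quarter_sum R k.*2 = (1 - 2 ^- k.*2) * hurwitz_zeta k.*2 (1 : R).
Proof.
move=> k0; have k1 : (1 < k.*2)%N by lia.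
have cv := cvg_double (odd_zeta_cvg k1).
have cv' : series (@quarter_term R k.*2) @ \oo --> quarter_sum R k.*2.
  by apply: quarter_series_cvg; lia.
suff E : (fun N => series (fun n => (2 * n%:R + 1 : R) ^- k.*2) N.*2) =
    series (@quarter_term R k.*2).
  by rewrite E in cv; exact: (cvg_unique _ cv' cv).
apply/funext => N; rewrite series_pair; apply: eq_bigr => n _.
rewrite /quarter_term invrN exprNn -signr_odd odd_double mul1r -natr1 -[n.*2]muln2 natrM.
by rewrite !exprVn; congr ((_ ^+ _)^-1 + (_ ^+ _)^-1); ring.
Qed.

Lemma hurwitz_quarter_cvg k (a : nat) : (1 < k)%N -> (0 < a)%N ->
  series (fun n => (4 * n%:R + a%:R : R) ^- k) @ \oo -->
    4 ^- k * hurwitz_zeta k (a%:R / 4%:R : R).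
Proof.
move=> k1 a0.
have E n : (4 * n%:R + a%:R : R) ^- k = 4 ^- k * (n%:R + a%:R / 4%:R) ^- k.
  by rewrite -invfM -exprMn; congr (_ ^+ _)^-1; field.
have -> : (series (fun n => (4 * n%:R + a%:R : R) ^- k)) =
  (fun N => 4 ^- k * series (fun n => (n%:R + a%:R / 4%:R) ^- k) N).
  apply/funext => N; rewrite /series /= mulr_sumr; apply: eq_bigr => n _.
  by rewrite E.
apply: cvgM; first exact: cvg_cst.
(* The majorant comes from n + a/4 >= (n+1)/4, valid since a >= 1. *)
apply: (@series_le_cvg _ _ (fun n => 4 ^+ k * n.+1%:R ^- 2)).
- by move=> n; rewrite invr_ge0 exprn_ge0.
- by move=> n; rewrite mulr_ge0.
- move=> n; rewrite -[leLHS](mulKf (x := 4 ^- k)) ?invr_eq0 ?expf_neq0 //.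
  rewrite -E invrK ler_wpM2l ?exprn_ge0 //.
  rewrite lef_pV2 ?posrE ?exprn_gt0 //; last by rewrite ltr_wpDl ?ltr0n // mulr_ge0.
  rewrite (le_trans (y := n.+1%:R ^+ k)) //; first by rewrite ler_weXn2l // ler1n.
  rewrite lerXn2r ?nnegrE // -?natrM -?natrD ?ler_nat //; lia.
- apply: (@is_cvg_seriesZ _ (fun n => n.+1%:R ^- 2) (4 ^+ k)).
  exact: inv_square_series_cvg.
Qed.

(** The residues 1 and 3 mod 4 together exhaust the odd integers, where [odd_zeta_cvg] applies. *)
Lemma hurwitz_quarterD k : (1 < k)%N ->
  hurwitz_zeta k (1%:R / 4%:R : R) + hurwitz_zeta k (3%:R / 4%:R : R) =
  (4 ^+ k - 2 ^+ k) * hurwitz_zeta k (1 : R).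
Proof.
move=> k1; have cv1 := @hurwitz_quarter_cvg k 1 k1 isT.
have cv3 := @hurwitz_quarter_cvg k 3 k1 isT.
have cv := cvg_double (odd_zeta_cvg k1).
have cvD : (fun N => series (fun n => (4 * n%:R + 1%:R : R) ^- k) N +
    series (fun n => (4 * n%:R + 3%:R : R) ^- k) N) @ \oo -->
    4 ^- k * hurwitz_zeta k (1%:R / 4%:R : R) + 4 ^- k * hurwitz_zeta k (3%:R / 4%:R : R).
  exact: cvgD.
have E : (fun N => series (fun n => (2 * n%:R + 1 : R) ^- k) N.*2) =
    (fun N => series (fun n => (4 * n%:R + 1%:R : R) ^- k) N +
    series (fun n => (4 * n%:R + 3%:R : R) ^- k) N).
  apply/funext => N; rewrite series_pair /series /= -big_split.
  apply: eq_bigr => n _ /=; rewrite -natr1 -muln2 natrM.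
  by congr ((_ ^+ _)^-1 + (_ ^+ _)^-1); ring.
rewrite E in cv; have : 4 ^- k * hurwitz_zeta k (1%:R / 4%:R : R) +
    4 ^- k * hurwitz_zeta k (3%:R / 4%:R : R) = (1 - 2 ^- k) * hurwitz_zeta k (1 : R).
  exact: (cvg_unique _ cvD cv).
have two0 : 2 ^+ k != 0 :> R by rewrite expf_neq0.
have -> : 4 ^+ k = 2 ^+ k * 2 ^+ k :> R by rewrite -exprMn; congr (_ ^+ _); ring.
rewrite -mulrDr => /(canRL (mulVKf _)) ->; last by rewrite mulf_neq0.
by field.
Qed.

(** For odd [k] the minus sign in -(4t+3) comes out of the power. *)
Lemma hurwitz_quarterB k : (1 < k)%N -> odd k ->
  hurwitz_zeta k (1%:R / 4%:R : R) - hurwitz_zeta k (3%:R / 4%:R : R) =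
  4 ^+ k * quarter_sum R k.
Proof.
move=> k1 kodd; have cv1 := @hurwitz_quarter_cvg k 1 k1 isT.
have cv3 := @hurwitz_quarter_cvg k 3 k1 isT.
have cvB : (fun N => series (fun n => (4 * n%:R + 1%:R : R) ^- k) N -
    series (fun n => (4 * n%:R + 3%:R : R) ^- k) N) @ \oo -->
    4 ^- k * hurwitz_zeta k (1%:R / 4%:R : R) - 4 ^- k * hurwitz_zeta k (3%:R / 4%:R : R).
  exact: cvgB.
have E : (fun N => series (fun n => (4 * n%:R + 1%:R : R) ^- k) N -
    series (fun n => (4 * n%:R + 3%:R : R) ^- k) N) = series (@quarter_term R k).
  apply/funext => N; rewrite /series /= -sumrB; apply: eq_bigr => n _.
  by rewrite /quarter_term invrN exprNn -signr_odd kodd expr1 mulN1r !exprVn.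
rewrite E in cvB.
have cv : series (@quarter_term R k) @ \oo --> quarter_sum R k.
  by apply: quarter_series_cvg; lia.
have : quarter_sum R k = 4 ^- k * hurwitz_zeta k (1%:R / 4%:R : R) -
    4 ^- k * hurwitz_zeta k (3%:R / 4%:R : R) by exact: (cvg_unique _ cv cvB).
by move=> ->; rewrite -mulrBr mulVKf // expf_neq0.
Qed.
End ZetaValues.

(** * The stuffle product *)

Section MultipleZeta.
Variable R : realType.
Implicit Types (a b k n : nat).

Definition inv_power k a : R := (a%:R + 1) ^- k.

Lemma inv_power_ge0 k a : 0 <= inv_power k a.
Proof. by rewrite invr_ge0 exprn_ge0 // addr_ge0. Qed.

Lemma inv_power_esum k : (1 < k)%N ->
  (\esum_(a in [set: nat]) (inv_power k a)%:E = (hurwitz_zeta k (1 : R))%:E)%E.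
Proof.
move=> k1; rewrite -nneseries_esumT => [|a]; last by rewrite lee_fin inv_power_ge0.
rewrite /hurwitz_zeta -EFin_lim; last exact/cvgP/zeta_series_cvg.
by congr (limn _); apply/funext => N; rewrite /= sumEFin.
Qed.

Lemma mzv1 k : (1 < k)%N -> mzv R [:: k] = hurwitz_zeta k (1 : R).
Proof.
move=> k1; rewrite /mzv -[RHS]/(fine (hurwitz_zeta k (1 : R))%:E) -inv_power_esum //.
congr fine; rewrite (reindex_esum setT _ (fun a => [tuple a.+1])).
  by apply: eq_esum => a _; rewrite big_ord1 /inv_power natr1.
split.
- by move=> a _; split.
- by move=> a b _ _ /(congr1 val) [].
- move=> t [_]; case/tupleP: t => x t; rewrite tuple0 /= andbT => x0.
  exists x.-1 => //; apply: val_inj => /=.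
  by rewrite prednK.
Qed.

Definition inv_power2 k (p : nat * nat) : \bar R :=
  (inv_power k p.1 * inv_power k p.2)%:E.

Lemma inv_power2_ge0 k p : (0 <= inv_power2 k p)%E.
Proof. by rewrite lee_fin mulr_ge0 // inv_power_ge0. Qed.

Lemma mzv2 k : mzv R [:: k; k] =
  fine (\esum_(p in [set p : nat * nat | (p.2 < p.1)%N]) inv_power2 k p).
Proof.
rewrite /mzv; congr fine.
rewrite (reindex_esum [set p : nat * nat | (p.2 < p.1)%N] _
  (fun p => [tuple p.1.+1; p.2.+1])).
  apply: eq_esum => p _; rewrite big_ord_recl big_ord1 /inv_power2 /inv_power.
  by rewrite !natr1.
split.
- by move=> p /= pp; split => //=; rewrite andbT.
- by move=> [a b] [c d] _ _ /(congr1 val) [-> ->].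
- move=> t []; case/tupleP: t => x t; case/tupleP: t => y t; rewrite tuple0 /=.
  rewrite !andbT => yx /andP[x0 y0]; exists (x.-1, y.-1) => /=.
    by rewrite -ltnS !prednK.
  by apply: val_inj => /=; rewrite !prednK.
Qed.

(** The terms are nonnegative, so the sum may be iterated and each factor pulled out. *)
Lemma inv_power2_esum k : (1 < k)%N ->
  (\esum_(p in [set: nat * nat]) inv_power2 k p = (hurwitz_zeta k (1 : R) ^+ 2)%:E)%E.
Proof.
move=> k1; set z := hurwitz_zeta k 1.
have -> : [set: nat * nat] = ([set: nat] `*`` (fun _ : nat => [set: nat]))%classic.
  by apply/seteqP; split.
rewrite -(esum_esum (a := fun a b => (inv_power k a * inv_power k b)%:E)); last first.
  by move=> a b _ _; rewrite lee_fin mulr_ge0 // inv_power_ge0.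
transitivity (\esum_(a in [set: nat]) (inv_power k a * z)%:E)%E.
  apply: eq_esum => a _; rewrite EFinM -inv_power_esum //.
  rewrite -!nneseries_esumT; last 2 first.
  - by move=> b; rewrite lee_fin inv_power_ge0.
  - by move=> b; rewrite lee_fin mulr_ge0 // inv_power_ge0.
  rewrite -nneseriesZl; last by move=> b _; rewrite lee_fin inv_power_ge0.
  by apply: eq_eseriesr => b _; rewrite EFinM.
have z0 : 0 <= z by rewrite ltW // zeta_gt0.
rewrite expr2 [in RHS]EFinM -{2}inv_power_esum //.
rewrite -!nneseries_esumT; last 2 first.
- by move=> b; rewrite lee_fin inv_power_ge0.
- by move=> b; rewrite lee_fin mulr_ge0 // inv_power_ge0.
rewrite -nneseriesZl; last by move=> b _; rewrite lee_fin inv_power_ge0.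
by apply: eq_eseriesr => b _; rewrite -EFinM mulrC.
Qed.

(** The pairs of indices split into a diagonal, which gives zeta(2k), and two triangles exchanged by
    swapping coordinates. *)
Lemma zeta_square k : (1 < k)%N ->
  hurwitz_zeta k (1 : R) ^+ 2 = 2 * mzv R [:: k; k] + mzv R [:: (k + k)%N].
Proof.
move=> k1; have tot := inv_power2_esum k1.
rewrite (esumID [set p : nat * nat | (p.2 < p.1)%N] _ _
  (fun p _ => inv_power2_ge0 k p)) !setTI in tot.
rewrite [X in (_ + X)%E](esumID [set p : nat * nat | p.1 = p.2] _ _
  (fun p _ => inv_power2_ge0 k p)) in tot.
rewrite (reindex_esum setT (_ `&` [set p : nat * nat | p.1 = p.2])
  (fun a => (a, a))) in tot.
2: {
  split.
  - by move=> a _ /=; split => //; rewrite ltnn.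
  - by move=> a b _ _ [].
  - by move=> [a b] /= [_ ->]; exists b.
}
rewrite (reindex_esum [set p : nat * nat | (p.2 < p.1)%N]
  (_ `&` ~` [set p : nat * nat | p.1 = p.2]) (fun p => (p.2, p.1))) in tot.
2: {
  split.
  - by move=> [a b] /= ba; split; [apply/negP; lia|lia].
  - by move=> [a b] [c d] _ _ [-> ->].
  - move=> [a b] /= [/negP ab nab]; exists (b, a) => //=; lia.
}
have diag : (\esum_(a in [set: nat]) inv_power2 k (a, a) =
    (mzv R [:: (k + k)%N])%:E)%E.
  rewrite mzv1; last by lia.
  rewrite -inv_power_esum; last by lia.
  by apply: eq_esum => a _; rewrite /inv_power2 /inv_power exprD invfM.
rewrite diag in tot.
have swap : (\esum_(p in [set p : nat * nat | (p.2 < p.1)%N]) inv_power2 k (p.2, p.1) =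
    \esum_(p in [set p : nat * nat | (p.2 < p.1)%N]) inv_power2 k p)%E.
  by apply: eq_esum => p _; rewrite /inv_power2 /= mulrC.
rewrite swap in tot; rewrite mzv2; move: tot.
have : (0 <= \esum_(p in [set p : nat * nat | (p.2 < p.1)%N]) inv_power2 k p)%E.
  by apply: esum_ge0 => p _; exact: inv_power2_ge0.
(* The total is finite and the triangle sum nonnegative, so that sum is a real number and [fine]
   loses nothing. *)
case: (esum _ _) => [x| |] //= _ [<-]; ring.
Qed.

End MultipleZeta.

(** * Zagier spaces *)

Lemma finite_bounded_seqs (m n : nat) :
  finite_set [set s : seq nat | (size s <= n)%N /\ all (ltn^~ m) s].
Proof.
elim: n => [|n IH].
  apply: (@sub_finite_set _ _ [set [::]]); last exact: finite_set1.
  by move=> [|x s] [].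
apply: (@sub_finite_set _ _ ([set [::]] `|` (fun p : nat * seq nat => p.1 :: p.2) @`
  (`I_m `*` [set s : seq nat | (size s <= n)%N /\ all (ltn^~ m) s]))).
  move=> [|x s] /= [sn]; first by left.
  by move=> /andP[xm sm]; right; exists (x, s).
rewrite finite_setU; split; first exact: finite_set1.
by apply: finite_image; apply: finite_setX.
Qed.

(** Positive exponents of sum [p] bound both the length and the entries by [p]. *)
Lemma finite_mzv_weight (R : realType) (p : nat) :
  finite_set [set x : R[i] | exists s : seq nat,
    [/\ mzv_exponents s, sumn s = p & x = (mzv R s)%:C]].
Proof.
apply: (@sub_finite_set _ _ ((fun s => (mzv R s)%:C) @`
  [set s : seq nat | (size s <= p)%N /\ all (ltn^~ p.+1) s])).
  move=> _ [s [[spos _] <- ->]]; exists s => //.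
  split; elim: s spos => //= x s IH /andP[x0 /IH {}IH].
    by rewrite -add1n leq_add.
  rewrite ltnS leq_addr /=; apply: sub_all IH => y.
  by rewrite !ltnS => /leq_trans -> //; rewrite leq_addl.
by apply: finite_image; exact: finite_bounded_seqs.
Qed.

(** The residues 1 and 3 are the only ones prime to 4, so the conjecture for q' = 4 concerns just
    two numbers. *)
Lemma lin_indep_quarters (R : realType) (F : set R[i]) (k : nat) (x y : R[i]) :
  lin_indep F (fun a : {a : 'I_4 | (1 <= a)%N && coprime a 4} =>
    (hurwitz_zeta k ((val a)%:R / 4%:R : R))%:C) ->
  F x -> F y ->
  x * (hurwitz_zeta k (1%:R / 4%:R : R))%:C +
    y * (hurwitz_zeta k (3%:R / 4%:R : R))%:C = 0 -> x = 0 /\ y = 0.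
Proof.
move=> indep Fx Fy xy0.
pose a1 : {a : 'I_4 | (1 <= a)%N && coprime a 4} :=
  exist _ (Ordinal (isT : (1 < 4)%N)) isT.
pose a3 : {a : 'I_4 | (1 <= a)%N && coprime a 4} :=
  exist _ (Ordinal (isT : (3 < 4)%N)) isT.
pose c (a : {a : 'I_4 | (1 <= a)%N && coprime a 4}) := if a == a1 then x else y.
have Fc a : F (c a) by rewrite /c; case: eqP.
have := indep c Fc; rewrite (bigD1 a1) //= (bigD1 a3) //= big1 ?addr0.
  by move=> /(_ xy0) c0; have := c0 a1; have := c0 a3.
by move=> [[[|[|[|[|]]]] ?] ?].
Qed.

(* Over the real field generated by zeta(k) / P(1)^k, which does not contain
   [i], the sum and the difference of zeta(k, 1/4) and zeta(k, 3/4) are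
   proportional. *)
Lemma zeta_ratio_transcendental (R : realType) (k : nat) (r : R) :
  gun_murty_rath R -> (1 < k)%N -> odd k ->
  hurwitz_zeta k (1 : R) = r * quarter_sum R 1 ^+ k ->
  ~ algebraic_number r%:C.
Proof.
move=> gmr k1 kodd zE alg.
have [F Fnum [Fr Fmin]] := simple_number_field alg.
have [s sE] := @quarter_sum_rational R k (ltnW k1).
have Freal : F `<=` range (fun x : R => x%:C).
  apply: Fmin.
  - by exists r.
  - by move=> c; exists (ratr c) => //; rewrite -[LHS]/(real_complex R _) fmorph_rat.
  - by move=> _ _ [x _ <-] [y _ <-]; exists (x + y) => //; rewrite rmorphD.
  - by move=> _ _ [x _ <-] [y _ <-]; exists (x * y) => //; rewrite rmorphM.
case: Fnum => L [iota FE].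
have FQ (c : rat) : F (ratr c) by rewrite FE; exists (ratr c); rewrite // fmorph_rat.
have FM x y : F x -> F y -> F (x * y) by rewrite FE; exact: range_rmorphM.
have FD x y : F x -> F y -> F (x + y).
  by rewrite FE => -[x' _ <-] [y' _ <-]; exists (x' + y'); rewrite ?rmorphD.
have FN x : F x -> F (- x) by rewrite FE; exact: range_rmorphN.
have Fnum : number_field F by exists L, iota.
have indep x y := @lin_indep_quarters R F k x y
  (gmr F k 4 Fnum k1 isT (real_cap_Qi FQ Freal)).
have sumE := hurwitz_quarterD R k1; have difE := hurwitz_quarterB R k1 kodd.
rewrite zE in sumE; rewrite sE in difE.
set u := hurwitz_zeta k (1%:R / _) in indep sumE difE.
set v := hurwitz_zeta k (3%:R / _) in indep sumE difE.
pose a : rat := 4 ^+ k - 2 ^+ k; pose b : rat := 4 ^+ k * s.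
have ratE (c : rat) : ratr c = (ratr c : R)%:C.
  by rewrite -[RHS]/(real_complex R _) fmorph_rat.
have aE : 4 ^+ k - 2 ^+ k = ratr a :> R.
  by rewrite rmorphB !rmorphXn !rmorph_nat.
have bE : 4 ^+ k * ratr s = ratr b :> R by rewrite rmorphM rmorphXn rmorph_nat.
(* Eliminating P(1)^k from u + v = a r P(1)^k and u - v = b P(1)^k gives b (u + v) - a r (u - v) =
   0. *)
have [|||e1 e2] := indep (ratr b - ratr a * r%:C) (ratr b + ratr a * r%:C).
- by apply: FD => //; apply: FN; apply: FM.
- by apply: FD => //; apply: FM.
- rewrite !ratE -aE -bE; apply/eqP; rewrite eq_complex; apply/andP.
  split; apply/eqP => /=; last by ring.
  transitivity (4 ^+ k * ratr s * (u + v) - (4 ^+ k - 2 ^+ k) * r * (u - v)).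
    by ring.
  by rewrite sumE difE; ring.
(* The difference of the two vanishing coefficients; since a is nonzero, r = 0 would follow and
   zeta(k) would vanish. *)
have : 2 * ratr a * r = 0.
  move: e1 e2; rewrite !ratE; move: (ratr a) (ratr b) => x y.
  move=> /(congr1 (@complex.Re R)) /= e1 /(congr1 (@complex.Re R)) /= e2.
  by move: e1 e2; rewrite mul0r; lra.
have a_neq0 : 2 * ratr a != 0 :> R.
  rewrite mulf_neq0 // fmorph_eq0 subr_eq0 gt_eqF // ltrXn2r //; lia.
move/eqP; rewrite mulf_eq0 (negPf a_neq0) /= => /eqP r0.
by have := zeta_gt0 R k1; rewrite zE r0 mul0r ltxx.
Qed.

Theorem theorem12 (R : realType) (q : nat) (K : set R[i]) (d : nat)
    (hq : (2 <= q)%N) (hK : number_field K)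
    (hKq : K `&` Qadjoin (zeta_root R q) = Qset R)
    (hd : (0 < d)%N) :
  gun_murty_rath R -> (2 <= dimension K (zagier_space K (4 * d + 2)))%N.
Proof.
move=> gmr; rewrite leqNgt; apply/negP; case: hK => L [iota ->] dim_lt2.
(* Twice this odd number is the weight [4 * d + 2], and [0 < d] gives [1 < k]. *)
pose k := (2 * d + 1)%N; have k1 : (1 < k)%N by lia.
have kodd : odd k by rewrite /k addn1 /= mul2n odd_double.
have inV s : mzv_exponents s -> sumn s = (4 * d + 2)%N ->
    zagier_space (range iota) (4 * d + 2) (mzv R s)%:C.
  by move=> s0 sp; apply: sub_lin_span; exists s.
have zeta_even_neq0 : (mzv R [:: (k + k)%N])%:C != 0.
  rewrite mzv1; last by lia.
  rewrite -(rmorph0 (real_complex R)) (inj_eq (@complexI _)) gt_eqF //.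
  by apply: zeta_gt0; lia.
have square_inV : zagier_space (range iota) (4 * d + 2)
    (hurwitz_zeta k (1 : R) ^+ 2)%:C.
  have [_ VD VZ] := span_submodule iota [set x | exists s : seq nat,
    [/\ mzv_exponents s, sumn s = (4 * d + 2)%N & x = (mzv R s)%:C]].
  rewrite zeta_square // rmorphD rmorphM; apply: VD.
    apply: VZ; first by exists 2 => //; rewrite !rmorph_nat.
    by apply: inV; [split => //=; lia|rewrite /=; lia].
  by apply: inV; [split => //=; lia|rewrite /=; lia].
have even_inV : zagier_space (range iota) (4 * d + 2) (mzv R [:: (k + k)%N])%:C.
  by apply: inV; [split => //=; lia|rewrite /=; lia].
have [_ [a _ <-] squareE] := proportional_of_dimension_lt2
  (finite_mzv_weight R (4 * d + 2)) dim_lt2 even_inV square_inV zeta_even_neq0.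
set z := hurwitz_zeta k 1 in squareE.
have z0 : 0 < z by exact: zeta_gt0.
have even_beta : exists c : rat,
    mzv R [:: (k + k)%N] = ratr c * (quarter_sum R 1 ^+ k) ^+ 2.
  have [s sE] := @quarter_sum_rational R k.*2 (ltac:(lia)).
  exists ((1 - 2 ^- k.*2)^-1 * s); rewrite mzv1 ?addnn; last by lia.
  have := @quarter_sum_even R k (ltnW k1); rewrite sE.
  have coef_neq0 : 1 - 2 ^- k.*2 != 0 :> R.
    rewrite subr_eq0 eq_sym invr_eq1 gt_eqF // exprn_egt1 ?ltr1n //; lia.
  move=> /(canLR (mulKf coef_neq0)) <-; rewrite -exprM muln2.
  by rewrite rmorphM fmorphV rmorphB rmorph1 fmorphV rmorphXn rmorph_nat mulrA.
have [c cE] := even_beta.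
(* Otherwise zeta(2k), a multiple of its square, would vanish. *)
have beta0 : quarter_sum R 1 ^+ k != 0.
  apply: contraNneq zeta_even_neq0 => beta0.
  by rewrite cE beta0 expr0n mulr0.
apply: (@zeta_ratio_transcendental R k (z / quarter_sum R 1 ^+ k) gmr k1 kodd).
  by rewrite divfK.
apply: algebraic_number_sqrt.
have ratE : iota (ratr c) = (ratr c : R)%:C.
  by rewrite fmorph_rat -[RHS]/(real_complex R _) fmorph_rat.
(* zeta(k)^2 is [iota a] times zeta(2k), and zeta(2k) is c times the square of P(1)^k. *)
have -> : (z / quarter_sum R 1 ^+ k)%:C ^+ 2 = iota (a * ratr c).
  rewrite [RHS]rmorphM ratE; set b := quarter_sum R 1 ^+ k in beta0 cE *.
  have bC0 : b%:C ^+ 2 != 0 by rewrite expf_neq0 // (inj_eq (@complexI _) _ 0).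
  apply: (mulIf bC0); move: squareE; rewrite cE.
  rewrite -exprMn -rmorphM divfK // rmorphXn => ->.
  by rewrite [(ratr c * _)%:C]rmorphM rmorphXn mulrA.
exact: algebraic_number_range.
Qed.
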